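(* Let $F_n$ be the free group on $n \geq 2$ generators. Let $\{H_i\alpha_i\}_{i=1}^{s}$ be a coset partition of $F_n$ with $H_i<F_n$ of index $d_i$, $\alpha_i \in F_n$, $1 \leq i \leq s$, and $1<d_1 \leq \dots\leq d_s$. Let $r$ be an integer, $4 \leq r \leq s-1$. Let $k=\max\{o_{max}(w)\mid w\in F_n\}$, let $p$ be the smallest prime dividing $k$, let $u\in F_n$ be such that $o_{max}(u)=k$, and let $\#=|\{1\le i\le s \mid o_{*i}(u)=k\}|$, where $\#\ge 2$. Suppose one of the following conditions holds: (i) $k>d_{s-2}$; (ii) $k>d_{s-3}$ and $p\geq 3$; (iii) $k>d_{s-3}$, $p=2$, and ($\#=2$ or $\# \geq 4$); (iv) $k>d_{s-r}$ and ($p\geq r$, or $\#=p$, or $\# \geq r+1$). Then the coset partition $\{H_i\alpha_i\}_{i=1}^{s}$ has multiplicity.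
   Context: A coset partition of a group $G$ is a finite family $\{H_i\alpha_i\}_{i=1}^{s}$ of right cosets of subgroups $H_i\le G$ ($\alpha_i\in G$) that are pairwise disjoint and whose union is $G$; here all $H_i$ have finite index $d_i$. It has multiplicity if $d_i=d_j$ for some $i\ne j$. For $w\in F_n$, $o_{*i}(w)$ is the least natural number $m\ge 1$ such that $w^{m}\in\alpha_i^{-1}H_i\alpha_i$ (equivalently, the length of the orbit of the coset $H_i\alpha_i$ under right multiplication by $w$; $1\le o_{*i}(w)\le d_i$). $o_{max}(w)=\max\{o_{*i}(w)\mid 1\le i\le s\}$. Equivalently, $k$ is the maximal length of a cycle occurring in the disjoint cycle decomposition of a permutation in $\bigcup_{i=1}^{s}T_i$, where $T_i$ is the group of permutations of the right cosets of $H_i$ induced by right multiplication by elements of $F_n$. *)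

(* Defs.v *)
From HB Require Import structures.
From mathcomp Require Import all_boot.
From mathcomp Require Import boolp classical_sets cardinality.

Set Implicit Arguments.
Unset Strict Implicit.
Unset Printing Implicit Defensive.

Local Open Scope group_scope.

Section FreeGroup.
Variable T : choiceType.

(* The letter (x, true) stands for x^-1. *)
Local Notation letter := (T * bool)%type.

Definition linv (x : letter) : letter := (x.1, ~~ x.2).

Definition reduced (s : seq letter) : bool :=
  sorted (fun x y => y != linv x) s.

Record free_group := FreeWord {
  word :> seq letter;
  word_reduced : reduced word }.

HB.instance Definition _ := [isSub for word].
HB.instance Definition _ := [Choice of free_group by <:].

Definition push (x : letter) (s : seq letter) : seq letter :=
  if s is y :: s' then if y == linv x then s' else x :: s else [:: x].

(* Reduced form of the concatenation s ++ t, for t reduced. *)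
Definition mulw (s t : seq letter) : seq letter := foldr push t s.

Definition invw (s : seq letter) : seq letter := rev (map linv s).

Lemma linvK : involutive linv.
Proof. by case=> x b; rewrite /linv negbK. Qed.

Lemma push_reduced x s : reduced s -> reduced (push x s).
Proof.
case: s => [//|y s] /= ys; case: ifPn => [_|yx].
  exact: path_sorted ys.
by rewrite /reduced /= yx.
Qed.

Lemma pushK x s : reduced s -> push x (push (linv x) s) = s.
Proof.
case: s => [_|y s /= ys] /=; first by rewrite eqxx.
rewrite linvK; case: eqP ys => [->|_] ys /=; last by rewrite eqxx.
by case: s ys => [//|z s /= /andP[/negPf->]].
Qed.

Lemma mulw_reduced s t : reduced t -> reduced (mulw s t).
Proof. by move=> rt; elim: s => //= x s; exact: push_reduced. Qed.

Lemma mulw_push x s t : reduced t -> mulw (push x s) t = push x (mulw s t).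
Proof.
move=> rt; case: s => [//|y s] /=; case: ifPn => [/eqP->|//].
by rewrite pushK // mulw_reduced.
Qed.

Lemma mulwA s t v : reduced v -> mulw s (mulw t v) = mulw (mulw s t) v.
Proof. by move=> rv; elim: s => //= x s IH; rewrite mulw_push // IH. Qed.

Lemma mulw0 s : reduced s -> mulw s [::] = s.
Proof.
elim: s => //= x s IH rs; rewrite (IH (path_sorted rs)).
by case: s rs {IH} => [//|y s] /= /andP[yx _]; rewrite (negPf yx).
Qed.

Lemma invwK : involutive invw.
Proof. by move=> s; rewrite /invw map_rev revK mapK //; exact: linvK. Qed.

Lemma invw_reduced s : reduced s -> reduced (invw s).
Proof.
rewrite /reduced /invw rev_sorted sorted_map; apply: sub_sorted => x y.
by apply: contraNN => /eqP /=; rewrite linvK => ->.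
Qed.

Lemma mulVw s : mulw (invw s) s = [::].
Proof.
elim: s => //= x s IH.
by rewrite /invw /= rev_cons /mulw foldr_rcons /= linvK eqxx.
Qed.

Definition fg_one := @FreeWord [::] isT.
Definition fg_mul (a b : free_group) :=
  FreeWord (mulw_reduced a (word_reduced b)).
Definition fg_inv (a : free_group) := FreeWord (invw_reduced (word_reduced a)).

Lemma fg_mulA : associative fg_mul.
Proof. by move=> a b c; apply: val_inj; rewrite /= mulwA ?word_reduced. Qed.
Lemma fg_mul1 : left_id fg_one fg_mul.
Proof. by move=> a; apply: val_inj. Qed.
Lemma fg_mul1r : right_id fg_one fg_mul.
Proof. by move=> a; apply: val_inj; rewrite /= mulw0 ?word_reduced. Qed.
Lemma fg_mulV : left_inverse fg_one fg_inv fg_mul.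
Proof. by move=> a; apply: val_inj; rewrite /= mulVw. Qed.
Lemma fg_mulVr : right_inverse fg_one fg_inv fg_mul.
Proof. by move=> a; apply: val_inj; rewrite /= -{1}[word a]invwK mulVw. Qed.

HB.instance Definition _ :=
  isGroup.Build free_group fg_mulA fg_mul1 fg_mul1r fg_mulV fg_mulVr.

Definition fg_gen (x : T) : free_group := @FreeWord [:: (x, false)] isT.

Lemma fg_universal (G : groupType) (f : T -> G) :
  exists! phi : free_group -> G,
    {morph phi : a b / a * b >-> a * b} /\ forall x, phi (fg_gen x) = f x.
Proof.
pose e (x : letter) : G := if x.2 then (f x.1)^-1 else f x.1.
have eV x : e (linv x) = (e x)^-1 by case: x => x [] /=; rewrite /e /= ?invgK.
pose ev (s : seq letter) : G := foldr (fun x g => e x * g) 1 s.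
have evp x s : ev (push x s) = e x * ev s.
  by case: s => //= y s; case: ifP => // /eqP->; rewrite eV mulgA mulgV mul1g.
have evM s t : ev (mulw s t) = ev s * ev t.
  by elim: s => [|x s IH] /=; rewrite ?mul1g // evp IH mulgA.
exists (fun a => ev a); split; first by split=> [a b|x] /=; rewrite ?evM ?mulg1.
move=> psi [psiM psig]; apply/funext=> a.
have psi1 : psi 1 = 1 by apply: (mulgI (psi 1)); rewrite -psiM !mulg1.
have psiV b : psi b^-1 = (psi b)^-1.
  by apply: (mulgI (psi b)); rewrite -psiM !mulgV.
case: a => s; elim: s => [|x s IH] rs /=.
  by rewrite (_ : FreeWord rs = 1) ?psi1 //; exact: val_inj.
have rs' : reduced s := path_sorted rs.
rewrite (IH rs').
have -> : FreeWord rs =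
    (if x.2 then (fg_gen x.1)^-1 else fg_gen x.1) * FreeWord rs'.
  apply: val_inj; have := mulw0 rs; rewrite /= mulw0 // => {1}<-.
  by case: x rs {IH} => x [].
by rewrite psiM /e; case: x.2; rewrite ?psiV psig.
Qed.

End FreeGroup.

Local Open Scope classical_set_scope.
Local Open Scope card_scope.

Section CosetPartition.
Variable G : groupType.
Implicit Types (H : set G) (a w : G).

Definition right_coset H a : set G := [set h * a | h in H].

Definition conj_set H a : set G := [set h ^ a | h in H].

Definition subgroup H : Prop := group_closed (fun x => x \in H).

Definition has_index H (d : nat) : Prop :=
  [set right_coset H a | a in [set: G]] #= `I_d.

Definition coset_partition s (H : 'I_s -> set G) (alpha : 'I_s -> G) : Prop :=
  [/\ forall i, subgroup (H i),
      trivIset [set: 'I_s] (fun i => right_coset (H i) (alpha i))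
    & \bigcup_i right_coset (H i) (alpha i) = [set: G]].

(* The least m >= 1 with w ^+ m in a^-1 H a, and 0 if there is none (which
   cannot happen when H is a subgroup of finite index). *)
Definition ostar H a w : nat :=
  if pselect (exists m, (0 < m) && (w ^+ m \in conj_set H a)) is left ex_m
  then ex_minn ex_m else 0.

Definition omax s (H : 'I_s -> set G) (alpha : 'I_s -> G) w : nat :=
  \max_(i < s) ostar (H i) (alpha i) w.

End CosetPartition.

Definition is_maximum (T : Type) (f : T -> nat) (k : nat) : Prop :=
  (exists x, f x = k) /\ (forall x, f x <= k).

(* Main.v *)
(* Along an orbit x, x u, x u^2, ... the coset H_i alpha_i is met, if at all, in
   a residue class modulo o_i(u), so the orbit yields a partition of the integers
   into residue classes.  By Newman's theorem, if the largest modulus k occurs in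
   it then it occurs at least p times, p being the least prime divisor of k.
   Hence # >= p, while d_i >= o_i(u) and k > d_{s-t} give # <= t; each of the
   four conditions then forces # = p.  So an orbit that meets one coset with
   o_i(u) = k meets all of them: the union over j of the H_i alpha_i u^j, which
   consists of exactly k cosets of H_i, is the same set for all these i, and
   comparing densities shows that the d_i are equal. *)
Require Import Defs.
From mathcomp Require Import all_boot all_order all_algebra all_field zify.
From mathcomp Require Import boolp classical_sets functions cardinality.

Set Implicit Arguments.
Unset Strict Implicit.
Unset Printing Implicit Defensive.

(** * Vanishing sums of roots of unity and residue class partitions *)

Section Cover.

Import GRing.Theory Num.Theory.
Local Open Scope ring_scope.

(** Since [m] divides [M], the shift of [j] by [m] modulo [M] permutes the class and multiplies the
    sum by [z ^+ m], which differs from 1; in a domain this kills the sum. *)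
Lemma sum_residue_class (R : idomainType) (M m a : nat) (z : R) :
  (0 < M)%N -> (m %| M)%N -> z ^+ M = 1 -> z ^+ m != 1 ->
  \sum_(j < M | j == a %[mod m]) z ^+ j = 0.
Proof.
case: M => // M _ mM zM zm; set S := \sum_(j < _ | _) _.
have : S = S * z ^+ m.
  rewrite mulr_suml {1}/S (reindex_inj (addIr (inZp m))) /=.
  apply: eq_big => [j|j _].
    by rewrite modn_dvdm // -modnDmr modn_dvdm // modnDmr modnDr.
  by rewrite expr_mod // exprD (expr_mod _ zM).
by move/eqP; rewrite -subr_eq0 -{1}[S]mulr1 -mulrBr mulf_eq0 subr_eq0
  [1 == _]eq_sym (negPf zm) orbF => /eqP.
Qed.

(* For 0 < q < pdiv k the power w ^+ q is still a primitive k-th root of unity,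
   so every monomial of Q sums to 0 over the class. *)
Lemma sum_horner_residue_class (R : idomainType) (k M m a : nat) (w : R)
    (Q : {poly R}) :
  k.-primitive_root w -> (0 < M)%N -> (k %| M)%N -> (m %| M)%N ->
  ~~ (k %| m)%N -> (size Q <= pdiv k)%N -> Q`_0 = 0 ->
  \sum_(j < M | j == a %[mod m]) Q.[w ^+ j] = 0.
Proof.
move=> w_prim M_gt0 /dvdnP[t defM] mM kNm Q_size Q0.
under eq_bigr => j _ do rewrite (horner_coef_wide _ Q_size).
rewrite exchange_big big1 //= => -[[|q] ltqp] _.
  by rewrite big1 // => j _; rewrite Q0 mul0r.
rewrite -mulr_sumr; under eq_bigr => j _ do rewrite exprAC.
rewrite sum_residue_class ?mulr0 //.
  by rewrite exprAC defM mulnC exprM (prim_expr_order w_prim) !expr1n.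
rewrite -exprM -(prim_order_dvd w_prim) Gauss_dvdr //.
rewrite /coprime eqn_leq gcdn_gt0 orbT andbT leqNgt; apply/negP => gt1.
have := leq_trans ltqp (pdiv_min_dvd gt1 (dvdn_gcdl k q.+1)).
by rewrite ltnNge dvdn_leq // dvdn_gcdr.
Qed.

(* Q vanishes at 0 and at the values w ^+ j of all classes modulo k except that
   of f 0: summing Q.[w ^+ j] over a full period leaves only the latter. *)
Lemma newman_znam (I : finType) (m : I -> nat) (f : nat -> I) (k : nat) :
  (forall i, 0 < m i <= k)%N ->
  (forall j j', (f j' == f j) = (j' == j %[mod m (f j)])) ->
  (1 < k)%N -> m (f 0%N) = k ->
  (pdiv k <= #|[set i | (m i == k) && [exists j : 'I_k, f j == i]]|)%N.
Proof.
move=> m_bd f_class k_gt1 mf0; set J := [set i | _]; rewrite leqNgt.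
apply/negP => ltJp; have k_gt0 := ltnW k_gt1.
have [w w_prim] := C_prim_root_exists k_gt0.
have w_neq0 : w != 0.
  apply/eqP => w0; have /eqP := prim_expr_order w_prim.
  by rewrite w0 expr0n gtn_eqF // eq_sym oner_eq0.
(* A common period of all the classes. *)
pose M := (\prod_i m i)%N.
have M_gt0 : (0 < M)%N by apply: prodn_gt0 => i; case/andP: (m_bd i).
have mM i : (m i %| M)%N by rewrite /M (bigD1 i) //= dvdn_mulr.
have kM : (k %| M)%N by rewrite -mf0.
have Jmem j : m (f j) = k -> f j \in J.
  move=> mfj; rewrite inE mfj eqxx; apply/existsP.
  by exists (Ordinal (ltn_pmod j k_gt0)); rewrite f_class mfj /= modn_mod.
(* The default is harmless: [rep] is only used on [J], where the search succeeds. *)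
pose rep i : nat := odflt (Ordinal k_gt0) [pick j : 'I_k | f j == i].
have repP i : i \in J -> f (rep i) = i.
  rewrite inE /rep => /andP[_ /existsP[j fj]].
  by case: pickP => [j' /eqP //|/(_ j)]; rewrite fj.
have w_eq j j' : m (f j) = k -> (w ^+ j' == w ^+ j) = (f j' == f j).
  by move=> mfj; rewrite (eq_prim_root_expr w_prim) f_class mfj.
pose Q : {poly algC} :=
  \prod_(i <- enum (J :\ f 0%N)) ('X - (w ^+ rep i)%:P) * 'X.
(* The roots exclude [f 0] and the factor ['X] adds one, so the degree of [Q] is [#|J|], which is
   less than [pdiv k]. *)
have Q_size : (size Q <= pdiv k)%N.
  rewrite size_mulX ?monic_neq0 ?monic_prod_XsubC // size_prod_XsubC -cardE.
  by move: ltJp; rewrite (cardsD1 (f 0%N) J) Jmem.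
have Q0 : Q`_0 = 0 by rewrite coefMX.
have Q_root j : m (f j) = k -> (Q.[w ^+ j] == 0) = (f j != f 0%N).
  move=> mfj; rewrite hornerM hornerX mulf_eq0 expf_eq0 (negPf w_neq0) andbF orbF.
  rewrite -/(root _ _).
  rewrite -(big_map (fun i => w ^+ rep i) predT (fun z => 'X - z%:P)).
  rewrite root_prod_XsubC; apply/mapP/idP => [[i]|fj0].
    rewrite mem_enum !inE => /andP[iN0 iJ] /eqP.
    by rewrite eq_sym w_eq // repP ?inE // => /eqP <-.
  exists (f j); first by rewrite mem_enum in_setD1 fj0 Jmem.
  by apply/esym/eqP; rewrite w_eq // repP ?Jmem.
have : \sum_(j < M) Q.[w ^+ j] = 0.
  have kN1 : ~~ (k %| 1)%N by rewrite dvdn1 gtn_eqF.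
  rewrite -[RHS](sum_horner_residue_class 0 w_prim M_gt0 kM (dvd1n M) kN1
    Q_size Q0).
  by apply: eq_bigl => j; rewrite !modn1.
(* A class other than that of [f 0] contributes nothing: it is empty, or has modulus [k] and
   consists of roots of [Q], or has modulus below [k] and sums to 0. *)
rewrite (partition_big (fun j : 'I_M => f j) predT) //= (bigD1 (f 0%N)) //=.
rewrite [X in _ + X]big1 ?addr0 => [/eqP|i iN0]; last first.
  case: (pickP (fun j : 'I_M => f j == i)) => [a /eqP fa|no_j]; last first.
    by rewrite big_pred0.
  have [mi|miN] := eqVneq (m i) k.
    by rewrite big1 // => j /eqP fj; apply/eqP; rewrite Q_root fj.
  under eq_bigl => j do rewrite -fa f_class fa.
  apply: (sum_horner_residue_class _ w_prim) => //.
  have /andP[mi_gt0 le_mi] := m_bd i.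
  by apply/negP => /(dvdn_leq mi_gt0) ge_mi; rewrite eqn_leq le_mi ge_mi in miN.
(* On the class of [f 0], [w ^+ j] is 1, so a positive multiple of [Q.[1]] remains, nonzero in
   characteristic 0. *)
rewrite (eq_bigr (fun=> Q.[1])) => [|j /eqP fj]; last first.
  congr Q.[_]; apply/eqP; rewrite -[X in _ == X](expr0 w) w_eq ?fj //.
have Q1 : Q.[1] != 0 by rewrite -(expr0 w) Q_root // eqxx.
rewrite sumr_const mulrn_eq0 (negPf Q1) orbF.
by move/pred0P/(_ (Ordinal M_gt0))/negbT/negP; apply; apply: eqxx.
Qed.

End Cover.

(** * Cosets, orbit lengths and densities *)

Section Cosets.

Local Open Scope group_scope.
Local Open Scope classical_set_scope.
Variable G : groupType.
Implicit Types (H : set G) (x y a w g : G).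

(** Replacing cosets by ordinals gives them a decidable equality and finite cardinals; surjectivity
    makes the index exactly [d]. *)
Definition coset_labelling H d (c : G -> 'I_d) : Prop :=
  (forall x y, (c x == c y) = (x / y \in H)) /\ (forall t, exists x, c x = t).

Lemma mem_right_coset H a x : (x \in right_coset H a) = (x / a \in H).
Proof.
apply/idP/idP => /set_mem; first by case=> h Hh <-; rewrite mulgK mem_set.
by move=> Hxa; apply/mem_set; exists (x / a); rewrite ?mulgVK.
Qed.

Lemma mem_conj_set H a x : (x \in conj_set H a) = (a * x / a \in H).
Proof.
apply/idP/idP => /set_mem.
  by case=> h Hh <-; rewrite conjgE !mulgA mulgV mul1g mulgK mem_set.
by move=> Hx; apply/mem_set; exists (a * x / a); rewrite // conjgE mulgVK mulKg.
Qed.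

Lemma right_coset_eqP H x y :
  subgroup H -> right_coset H x = right_coset H y <-> x / y \in H.
Proof.
move=> [H1 HF]; split=> [eqxy|Hxy].
  by rewrite -mem_right_coset -eqxy mem_right_coset mulgV.
have HM := group_closedM (conj H1 HF).
have Hyx : y / x \in H by rewrite -invgF -[_^-1]mul1g; apply: HF.
apply/seteqP; split=> z /mem_set; rewrite mem_right_coset => Hz; apply/set_mem.
  by rewrite mem_right_coset -(divgKA x z y^-1); apply: HM.
by rewrite mem_right_coset -(divgKA y z x^-1); apply: HM.
Qed.

Lemma has_index_labelling H d :
  subgroup H -> has_index H d -> exists c : G -> 'I_d, coset_labelling H c.
Proof.
move=> Hsub /pcard_eqP[f]; have [f_fun f_inj f_surj] := @bij _ _ _ _ f.
have f_lt x : f (right_coset H x) < d by apply: f_fun; exists x.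
exists (fun x => Ordinal (f_lt x)); split=> [x y|t].
  rewrite -val_eqE /=; apply/eqP/idP => [eqf|/(right_coset_eqP _ _ Hsub) -> //].
  apply/(right_coset_eqP _ _ Hsub); apply: f_inj => //; apply: mem_set.
    by exists x.
  by exists y.
have [_ [x _ <-] fx] := f_surj t (ltn_ord t).
by exists x; apply: val_inj.
Qed.

Lemma coset_labellingM H d (c : G -> 'I_d) x y g :
  coset_labelling H c -> (c (x * g) == c (y * g)) = (c x == c y).
Proof. by move=> [cP _]; rewrite !cP mulgKA. Qed.

Section Ostar.

Variables (H : set G) (d : nat) (c : G -> 'I_d).
Hypothesis cP : coset_labelling H c.

(** By pigeonhole two of the [d.+1] cosets of [a * w ^+ j], [j <= d], coincide, so some positive
    exponent at most [d] fixes the coset of [a]; Euclidean division by the least one shows that it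
    divides all the others. *)
Lemma ostarP a w :
  0 < ostar H a w <= d /\
  forall m, (c (a * w ^+ m) == c a) = (ostar H a w %| m).
Proof.
pose P m := c (a * w ^+ m) == c a.
have conjP m : (w ^+ m \in conj_set H a) = P m by rewrite mem_conj_set -cP.1.
have PD m n : P m -> P (m + n) = P n.
  by rewrite /P expgnDr mulgA -(coset_labellingM _ _ (w ^+ n) cP) => /eqP ->.
have [j [j' [lt_jj' le_j'd eq_c]]] :
    exists j j', [/\ j < j', j' <= d & c (a * w ^+ j) = c (a * w ^+ j')].
  have /injectivePn[j [j' neq_jj' eq_c]] :
    ~~ injectiveb (fun j : 'I_d.+1 => c (a * w ^+ j)).
    by apply/injectiveP => /leq_card; rewrite !card_ord ltnn.
  by case: (ltngtP j j') neq_jj' => [lt|gt|/val_inj ->]; rewrite ?eqxx // => _;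
    [exists j, j'|exists j', j]; split; rewrite // -ltnS ltn_ord.
have Psub : P (j' - j).
  rewrite /P -(coset_labellingM _ _ (w ^+ j) cP) -mulgA -expgnDr subnK ?eq_c //.
  exact: ltnW.
have ex_m : exists m, (0 < m) && (w ^+ m \in conj_set H a).
  by exists (j' - j); rewrite subn_gt0 lt_jj' conjP.
(* The exponent found above excludes the default value 0 of [ostar]. *)
rewrite /ostar; case: pselect => // {}ex_m.
case: ex_minnP => o /andP[o_gt0]; rewrite conjP => Po o_min; split.
  rewrite o_gt0 (leq_trans _ le_j'd) // (leq_trans _ (leq_subr j j')) //.
  by rewrite o_min // conjP subn_gt0 lt_jj'.
have Pmul q : P (q * o)%N by elim: q => [|q IHq]; rewrite ?mulSn ?PD // /P mulg1.
move=> m; rewrite -/(P m) {1}(divn_eq m o) PD //.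
apply/idP/idP => [Pm|/eqP ->]; last by rewrite /P mulg1.
rewrite /dvdn -[_ == 0]negbK -lt0n; apply/negP => m_gt0.
by have := ltn_pmod m o_gt0; rewrite ltnNge o_min ?m_gt0 ?conjP.
Qed.

Lemma ostar_period a w x j j' :
  c (x * w ^+ j) = c a ->
  (c (x * w ^+ j') == c a) = (j' == j %[mod ostar H a w]).
Proof.
move=> cj; have [_ oP] := ostarP a w; case: (leqP j j') => [le_jj'|/ltnW le_j'j].
  rewrite eqn_mod_dvd // -oP -{1}(subnKC le_jj') expgnDr mulgA.
  by move/eqP: cj; rewrite -(coset_labellingM _ _ (w ^+ (j' - j)) cP) => /eqP->.
rewrite [RHS]eq_sym eqn_mod_dvd // -oP -(coset_labellingM _ _ (w ^+ (j - j')) cP).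
by rewrite -mulgA -expgnDr subnKC // cj eq_sym.
Qed.

End Ostar.

(* T is a finite transitive G-set above the cosets of H, so its fibres over
   these cosets all have the same cardinality. *)
Lemma card_equivariant (X : finType) (F : G -> X) H d (c : G -> 'I_d)
    (pi : X -> 'I_d) (A : {set 'I_d}) :
  coset_labelling H c ->
  (forall x y g, F x = F y -> F (x * g) = F (y * g)) ->
  (forall x, pi (F x) = c x) ->
  let T := [set t : X | `[< exists x, F x = t >]]%SET in
  (#|[set t in T | pi t \in A]%SET| * d = #|T| * #|A|)%N.
Proof.
move=> cP FM piF T.
have [r rP] : {r : X -> G & forall t, t \in T -> F (r t) = t}.
  apply: (@choice X G (fun t x => t \in T -> F x = t)) => t.
  have [|tN] := boolP (t \in T); last by exists 1.
  by rewrite inE => /asboolP[x Fx]; exists x.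
have FT x : F x \in T by rewrite inE; apply/asboolP; exists x.
pose fib (i : 'I_d) := [set t in T | pi t == i]%SET.
have le_fib (a b : 'I_d) : #|fib a| <= #|fib b|.
  have [[x cx] [y cy]] := (cP.2 a, cP.2 b).
  (* Right translation by [x^-1 * y] carries the fibre over [a = c x] into the fibre over [b = c y],
     and is undone by the inverse translation. *)
  pose h t := F (r t * (x^-1 * y)).
  have h_inj : {in fib a &, injective h}.
    move=> t t' /setIdP[tT _] /setIdP[t'T _] /(FM _ _ (x^-1 * y)^-1).
    by rewrite !mulgK !rP.
  rewrite -(card_in_imset h_inj); apply: subset_leq_card.
  apply/fintype.subsetP => t' /imsetP[t /setIdP[tT pit] ->{t'}].
  rewrite inE FT /= piF -cy.
  move: pit; rewrite -{1}[t]rP // piF -cx.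
  by rewrite -(coset_labellingM _ _ (x^-1 * y) cP) mulVKg.
have card_fib (a b : 'I_d) : #|fib a| = #|fib b|.
  by apply/eqP; rewrite eqn_leq !le_fib.
have count (a : 'I_d) (B : {set 'I_d}) :
    #|[set t in T | pi t \in B]%SET| = (#|B| * #|fib a|)%N.
  rewrite -sum_nat_const -sum1_card (partition_big pi (mem B)) /= => [|t /setIdP[] //].
  apply: eq_bigr => b bB; rewrite (card_fib a b) -sum1_card.
  apply: eq_bigl => t; rewrite !inE -andbA; congr (_ && _).
  by apply: andb_idl => /eqP ->.
have cardT (a : 'I_d) : #|T| = (d * #|fib a|)%N.
  rewrite -[X in (X * _)%N](card_ord d) -cardsT -count.
  by apply: eq_card => t; rewrite !inE andbT.
by rewrite (count (c 1)) (cardT (c 1)) mulnC mulnA mulnAC.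
Qed.

(** The set described by [A1] and by [A2] has density [#|A1| / d1] and also [#|A2| / d2]. Both are
    measured in the finite set of pairs of labels attained on [G], which stands for the cosets of
    the intersection of [H1] and [H2]. *)
Lemma eq_index H1 H2 d1 d2 (c1 : G -> 'I_d1) (c2 : G -> 'I_d2)
    (A1 : {set 'I_d1}) (A2 : {set 'I_d2}) :
  coset_labelling H1 c1 -> coset_labelling H2 c2 ->
  (forall x, (c1 x \in A1) = (c2 x \in A2)) ->
  #|A1| = #|A2| -> 0 < #|A1| -> d1 = d2.
Proof.
move=> c1P c2P eqA eq_card A1_gt0; pose F x := (c1 x, c2 x).
have FM x y g : F x = F y -> F (x * g) = F (y * g).
  case=> /eqP eq1 /eqP eq2; congr (_, _); apply/eqP.
    by rewrite (coset_labellingM _ _ _ c1P).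
  by rewrite (coset_labellingM _ _ _ c2P).
pose T := [set t | `[< exists x, F x = t >]]%SET.
have := card_equivariant A1 c1P FM (fun x => erefl : (F x).1 = c1 x).
rewrite /= -/T eq_card.
rewrite -(card_equivariant A2 c2P FM (fun x => erefl : (F x).2 = c2 x)) -/T.
have -> : [set t in T | t.2 \in A2]%SET = [set t in T | t.1 \in A1]%SET.
  apply/setP => t; rewrite !inE; apply: andb_id2l => /asboolP[x <-] /=.
  by rewrite eqA.
move/eqP; rewrite eqn_pmul2l => [/eqP -> //|].
have /card_gt0P[a aA] := A1_gt0; have [x cx] := c1P.2 a.
apply/card_gt0P; exists (F x); rewrite !inE /= cx aA andbT.
by apply/asboolP; exists x.
Qed.

End Cosets.

(** * Orbits of [u] in a coset partition *)

Section Partition.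

Local Open Scope group_scope.
Variables (G : groupType) (s : nat) (H : 'I_s -> set G) (alpha : 'I_s -> G).
Variables (d : 'I_s -> nat) (u : G) (k : nat).
Hypothesis H_part : coset_partition H alpha.
Hypothesis H_index : forall i, has_index (H i) (d i).
Hypothesis k_gt1 : 1 < k.
Hypothesis ostar_le : forall i, ostar (H i) (alpha i) u <= k.
Let o i := ostar (H i) (alpha i) u.

Let labelling i : {c : G -> 'I_(d i) | coset_labelling (H i) c}.
Proof. by apply/cid/has_index_labelling => //; case: H_part. Qed.

Let c i := sval (labelling i).
Let cP i : coset_labelling (H i) (c i) := svalP (labelling i).

Let block_ex x : {i | x \in right_coset (H i) (alpha i)}.
Proof.
case: H_part => _ _ cover; apply: cid.
have [i _ xi] : (\bigcup_i right_coset (H i) (alpha i))%classic x by rewrite cover.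
by exists i; apply/mem_set.
Qed.

Let block x := sval (block_ex x).

Let blockE x i : (block x == i) = (c i x == c i (alpha i)).
Proof.
rewrite (cP i).1 -mem_right_coset; have x_in := svalP (block_ex x).
apply/eqP/idP => [<- //|x_in_i]; case: H_part => _ triv _.
by apply: triv => //; exists x; split; apply/set_mem.
Qed.

Lemma block_class x j j' :
  (block (x * u ^+ j') == block (x * u ^+ j)) =
    (j' == j %[mod o (block (x * u ^+ j))]).
Proof.
set i := block (x * _ ^+ j); rewrite blockE.
by apply: (ostar_period (cP i)); apply/eqP; rewrite -blockE.
Qed.

Lemma pdiv_le_card_orbit x : o (block x) = k ->
  pdiv k <=
    #|[set i | (o i == k) && [exists j : 'I_k, block (x * u ^+ j) == i]]|.
Proof.
move=> ox; apply: (@newman_znam _ o (fun j => block (x * u ^+ j))) => //.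
- by move=> i; rewrite ostar_le andbT; case: (ostarP (cP i) (alpha i) u) => /andP[].
- exact: block_class.
- by rewrite mulg1.
Qed.

Let I := [set i | o i == k].

Lemma pdiv_le_card : 0 < #|I| -> pdiv k <= #|I|.
Proof.
case/card_gt0P=> i; rewrite inE => /eqP oi.
(* The orbit started at [alpha i] meets block [i] at time 0, so Newman's bound applies to it. *)
have block_i : block (alpha i) = i by apply/eqP; rewrite blockE.
apply: leq_trans (@pdiv_le_card_orbit (alpha i) _) _; first by rewrite block_i.
by apply: subset_leq_card; apply/fintype.subsetP => i'; rewrite !inE => /andP[].
Qed.

Lemma eq_index_of_card_pdiv : #|I| = pdiv k ->
  {in I &, forall i i', d i = d i'}.
Proof.
move=> cardI i i' iI i'I; have k_gt0 := ltnW k_gt1.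
(* The inverse powers make membership of [x] mean that the forward orbit of [x] meets block [i]. *)
pose A i := [set c i (alpha i * u ^- j) | j : 'I_k].
have A_mem i0 x : i0 \in I ->
    reflect (exists j, block (x * u ^+ j) = i0) (c i0 x \in A i0).
  rewrite inE => /eqP oi0; apply: (iffP imsetP) => [[j _ cx]|[j xj]].
    exists j; apply/eqP; rewrite blockE.
    rewrite -[alpha i0](mulgVK (u ^+ j)).
    by rewrite (coset_labellingM _ _ _ (cP i0)) cx.
  exists (Ordinal (ltn_pmod j k_gt0)) => //; apply/eqP.
  rewrite -(coset_labellingM _ _ (u ^+ (j %% k)) (cP i0)) mulgVK -blockE.
  by rewrite -xj block_class xj oi0 modn_mod.
have A_card i0 : i0 \in I -> #|A i0| = k.
  rewrite inE => /eqP oi0; rewrite card_imset ?card_ord // => j j' /eqP eq_c.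
  have cj : c i0 (alpha i0 * u ^- j * u ^+ j) = c i0 (alpha i0) by rewrite mulgVK.
  have := ostar_period (cP i0) j' cj.
  rewrite -/(o i0) oi0 !modn_small // -{2}[alpha i0](mulgVK (u ^+ j')).
  by rewrite (coset_labellingM _ _ _ (cP i0)) eq_c => /esym/eqP/val_inj.
have sub_A i1 i2 x : i1 \in I -> i2 \in I -> c i1 x \in A i1 -> c i2 x \in A i2.
  move=> i1I i2I /(A_mem _ _ i1I)[j xj]; apply/(A_mem _ _ i2I).
  have oxj : o (block (x * u ^+ j)) = k by rewrite xj; move: i1I; rewrite inE => /eqP.
  have := pdiv_le_card_orbit oxj; set J := finset _ => le_pJ.
  (* The orbit meets at least [pdiv k] members of [I], which has no more than that, so it meets them
     all. *)
  have JI : J = I.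
    apply/eqP; rewrite eqEcard cardI le_pJ andbT.
    by apply/fintype.subsetP => i0; rewrite !inE => /andP[].
  move: i2I; rewrite -JI inE => /andP[_ /existsP[j' /eqP xjj']].
  by exists (j + j')%N; rewrite expgnDr mulgA.
apply: (eq_index (A1 := A i) (A2 := A i') (cP i) (cP i')).
- by move=> x; apply/idP/idP; apply: sub_A.
- by rewrite !A_card.
- by rewrite A_card.
Qed.

End Partition.

(** * From the four conditions to # = p *)

Lemma card_ord_ge s t : #|[set i : 'I_s | t <= i]| = s - t.
Proof.
rewrite cardsE -sum1_card -(big_mkord (fun i => t <= i) (fun=> 1)).
by rewrite -(@big_nat_widenl _ _ _ t 0 s predT (fun=> 1)) // sum_nat_const_nat muln1.
Qed.

(* The 1-based d_1 <= ... <= d_s are the entries of d: d_j is nth 0 d j.-1. *)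
Theorem theorem2 (n s r : nat)
    (H : 'I_s -> set (free_group 'I_n)) (alpha : 'I_s -> free_group 'I_n)
    (d : s.-tuple nat) (k p c : nat) (u : free_group 'I_n)
    (n_ge2 : 2 <= n)
    (H_part : coset_partition H alpha)
    (H_index : forall i : 'I_s, has_index (H i) (tnth d i))
    (d_gt1 : forall i : 'I_s, 1 < tnth d i)
    (d_sorted : sorted leq d)
    (r_bounds : 4 <= r <= s - 1)
    (k_max : is_maximum (omax H alpha) k)
    (p_def : p = pdiv k)
    (u_max : omax H alpha u = k)
    (c_def : c = #|[set i : 'I_s | ostar (H i) (alpha i) u == k]|)
    (c_ge2 : 2 <= c)
    (cond :
      [\/ nth 0 d (s - 2).-1 < k,
          nth 0 d (s - 3).-1 < k /\ 3 <= p,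
          [/\ nth 0 d (s - 3).-1 < k, p = 2 & c = 2 \/ 4 <= c]
        | nth 0 d (s - r).-1 < k /\ [\/ r <= p, c = p | r.+1 <= c]]) :
  exists i j : 'I_s, i != j /\ tnth d i = tnth d j.
Proof.
have [r_ge4 r_lt_s] := andP r_bounds.
have ostar_le i : ostar (H i) (alpha i) u <= k by rewrite -u_max leq_bigmax.
have ostar_le_d i : ostar (H i) (alpha i) u <= tnth d i.
  have [/(_ i) Hi _ _] := H_part; have [l lP] := has_index_labelling Hi (H_index i).
  by case: (ostarP lP (alpha i) u) => /andP[].
(* If [ostar] equals [k] at [i], then [tnth d i] exceeds the entry at 0-based position [(s - t).-1];
   as [d] is sorted, [i] is one of the last [t] indices. *)
have card_le t : 0 < t < s -> nth 0 d (s - t).-1 < k -> c <= t.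
  move=> /andP[t_gt0 lt_ts] lt_dk; rewrite c_def -[t in _ <= t](subKn (ltnW lt_ts)).
  rewrite -card_ord_ge; apply: subset_leq_card; apply/fintype.subsetP => i.
  rewrite !inE => /eqP oi; rewrite leqNgt; apply/negP => lt_i.
  have := leq_trans lt_dk (eq_leq (esym oi)); rewrite ltnNge => /negP[].
  apply: leq_trans (ostar_le_d i) _; rewrite (tnth_nth 0).
  by apply: (sorted_leq_nth leq_trans leqnn) => //; rewrite ?inE ?size_tuple; lia.
have k_gt1 : 1 < k.
  have d_ge2 t : 0 < t < s -> 1 < nth 0 d (s - t).-1.
    move=> /andP[t_gt0 lt_ts]; have lt_s : (s - t).-1 < s by lia.
    by have := d_gt1 (Ordinal lt_s); rewrite (tnth_nth 0).
  by case: cond => [lt|[lt _]|[lt _ _]|[lt _]];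
    apply: leq_trans (d_ge2 _ _) (ltnW lt); lia.
have p_le_c : p <= c.
  by rewrite p_def c_def; apply: pdiv_le_card => //; rewrite -c_def ltnW.
have p_ge2 : 2 <= p by rewrite p_def prime_gt1 ?pdiv_prime.
(* With [2 <= p <= c], the bound [c <= t] for [t] equal to 2, 3, 3 and [r] respectively leaves only
   [c = p]; it refutes the alternatives [4 <= c] and [r.+1 <= c]. *)
have eq_cp : c = p.
  by case: cond => [|[]|[]|[]] /card_le le_ct => [|?|? ?|[]]; lia.
have /card_gt1P[i [i' [iI i'I neq_ii']]] :
    1 < #|[set i : 'I_s | ostar (H i) (alpha i) u == k]| by rewrite -c_def.
exists i, i'; split=> //.
apply: (eq_index_of_card_pdiv H_part H_index k_gt1 ostar_le _ iI i'I).
by rewrite -c_def eq_cp.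
Qed.
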